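(* For all integers $n\ge 1$, $$n!\ge \sqrt{2\pi n}\left(\frac{n}{e}\right)^n \exp\left(\frac{1}{12n}-\frac{1}{360n^3}+\frac{1}{1260n^5+945n^3}\right).$$
   Context: Here $e$ is the base of the natural logarithm, $\exp(x)=e^x$, and $n!$ is the usual factorial. *)

(* Defs.v *)
From Stdlib Require Import Reals Factorial.

(* Main.v *)
Require Import Defs.
From Stdlib Require Import Reals Factorial.
From Stdlib Require Import Lra Lia.
From Coquelicot Require Import Coquelicot.
Open Scope R_scope.

(** Write [log_stirling n = ln n! - (n + 1/2) ln n + n] and let [correction n] be the
    exponent in the bound. Taking logarithms, the claim is that
    [r n = log_stirling n - correction n] is at least [ln (2 pi) / 2]. The sequence [r]
    decreases to a limit that is at least this number, and each term lies above the limit.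

    Monotonicity ([log_stirling_step_lower]). With [u = 1 / (2 n + 1)] the decrement of
    [log_stirling] at [n] is [ln ((1 + u) / (1 - u)) / (2 u) - 1], that is
    [u^2/3 + u^4/5 + u^6/7 + ...]. This series and the decrement of [correction] first
    differ at order [n^-10], where the series is larger; keeping the terms through
    [u^8/9] already wins, which is a polynomial inequality in [(2 n + 1)^2]
    ([correction_diff]).

    Limit ([log_stirling_sub_correction_ge]). The increasing companion sequence
    [log_stirling n - 1/(4 n)] bounds [r] from below ([log_stirling_ge]), so [r] converges
    to some [l]. Integrals of powers of the sine give the Wallis bound
    [pi n (binom(2n, n) / 4^n)^2 <= 1]; its logarithm reads
    [2 log_stirling n - log_stirling (2 n) >= ln (2 pi) / 2] ([log_stirling_double]).
    As [correction n] tends to [0], passing to the limit gives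
    [2 l - l >= ln (2 pi) / 2]. *)

(** * Wallis integrals and the central binomial coefficient *)

Lemma sin_bounds_first_quadrant (x : R) : 0 <= x <= PI / 2 -> 0 <= sin x <= 1.
Proof.
  intros Hx. split; [| apply SIN_bound].
  pose proof PI_RGT_0. apply sin_ge_0; lra.
Qed.

Definition wallis (k : nat) : R := RInt (fun x => sin x ^ k) 0 (PI / 2).

Lemma continuous_sin_pow (k : nat) (x : R) : continuous (fun x => sin x ^ k) x.
Proof. apply (ex_derive_continuous (fun x => sin x ^ k)). auto_derive. exact I. Qed.

Lemma ex_RInt_sin_pow (k : nat) : ex_RInt (fun x => sin x ^ k) 0 (PI / 2).
Proof.
  apply (ex_RInt_continuous (V := R_CompleteNormedModule)).
  intros x _. apply continuous_sin_pow.
Qed.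

Lemma wallis_0 : wallis 0 = PI / 2.
Proof.
  unfold wallis. simpl. rewrite RInt_const. unfold scal; simpl; unfold mult; simpl. lra.
Qed.

Lemma wallis_1 : wallis 1 = 1.
Proof.
  assert (H : is_RInt (fun x => sin x ^ 1) 0 (PI / 2)
                (minus ((fun x => - cos x) (PI / 2)) ((fun x => - cos x) 0))).
  { apply (is_RInt_derive (fun x => - cos x)).
    - intros x _. auto_derive; [exact I | ring].
    - intros x _. apply continuous_sin_pow. }
  unfold wallis. rewrite (is_RInt_unique _ _ _ _ H).
  cbv [minus plus opp]; simpl. rewrite cos_PI2, cos_0. lra.
Qed.

(** Integration by parts, in the form: [- cos x * sin x ^ (k+1)] vanishes at both
    ends and has derivative [(k+2) sin x ^ (k+2) - (k+1) sin x ^ k]. *)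
Lemma wallis_rec (k : nat) : INR (k + 2) * wallis (k + 2) = INR (k + 1) * wallis k.
Proof.
  set (F := fun x => - cos x * sin x ^ (k + 1)).
  set (f := fun x => INR (k + 2) * sin x ^ (k + 2) - INR (k + 1) * sin x ^ k).
  assert (HF : is_RInt f 0 (PI / 2) (minus (F (PI / 2)) (F 0))).
  { apply (is_RInt_derive F f).
    - intros x _. unfold F, f. auto_derive; [exact I |].
      replace (Init.Nat.pred (k + 1)) with k by lia.
      replace (k + 2)%nat with (S (S k)) by lia.
      replace (k + 1)%nat with (S k) by lia.
      pose proof (sin2_cos2 x) as Hx. unfold Rsqr in Hx.
      assert (Hc : cos x * cos x = 1 - sin x * sin x) by lra.
      rewrite (S_INR (S k)). cbn [pow].
      transitivity (sin x * (sin x * sin x ^ k) - INR (S k) * (cos x * cos x) * sin x ^ k).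
      + ring.
      + rewrite Hc. ring.
    - intros x _. apply (ex_derive_continuous f). unfold f. auto_derive. exact I. }
  assert (Hends : minus (F (PI / 2)) (F 0) = 0).
  { cbv [minus plus opp F]; simpl. rewrite cos_PI2, sin_0, pow_i by lia. ring. }
  rewrite Hends in HF.
  assert (Hf : is_RInt f 0 (PI / 2)
                 (INR (k + 2) * wallis (k + 2) - INR (k + 1) * wallis k)).
  { apply (is_RInt_minus (V := R_NormedModule)
             (fun x => INR (k + 2) * sin x ^ (k + 2)) (fun x => INR (k + 1) * sin x ^ k));
      apply (is_RInt_scal (V := R_NormedModule)); apply (RInt_correct (V := R_CompleteNormedModule));
      apply ex_RInt_sin_pow. }
  pose proof (is_RInt_unique _ _ _ _ HF) as E0.
  rewrite (is_RInt_unique _ _ _ _ Hf) in E0. lra.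
Qed.

Lemma wallis_decr (k : nat) : 0 <= wallis (S k) <= wallis k.
Proof.
  pose proof PI_RGT_0. unfold wallis. split.
  - apply RInt_ge_0; [lra | apply ex_RInt_sin_pow |].
    intros x Hx. apply pow_le, sin_bounds_first_quadrant. lra.
  - apply RInt_le; [lra | apply ex_RInt_sin_pow | apply ex_RInt_sin_pow |].
    intros x Hx. simpl.
    pose proof (sin_bounds_first_quadrant x ltac:(lra)).
    pose proof (pow_le (sin x) k ltac:(lra)). nra.
Qed.

(** By [wallis_rec] this product does not depend on [k]; at [k = 0] it is [pi / 2]. *)
Lemma wallis_mul_succ (k : nat) : INR (k + 1) * (wallis k * wallis (k + 1)) = PI / 2.
Proof.
  induction k as [|k IH].
  - simpl. rewrite wallis_0, wallis_1. lra.
  - rewrite <- IH. pose proof (wallis_rec k) as Hr.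
    replace (S k + 1)%nat with (k + 2)%nat by lia.
    replace (S k) with (k + 1)%nat by lia.
    transitivity (wallis (k + 1) * (INR (k + 2) * wallis (k + 2))); [ring |].
    rewrite Hr. ring.
Qed.

Lemma wallis_even (n : nat) :
  wallis (2 * n) = PI / 2 * (INR (fact (2 * n)) / (4 ^ n * INR (fact n) ^ 2)).
Proof.
  induction n as [|n IH].
  - simpl. rewrite wallis_0. field.
  - pose proof (wallis_rec (2 * n)) as Hr. rewrite IH in Hr.
    replace (2 * S n)%nat with (2 * n + 2)%nat by lia.
    assert (Hpos := pos_INR n).
    assert (Hf : INR (fact n) <> 0) by apply INR_fact_neq_0.
    assert (H4 : 4 ^ n <> 0) by (apply pow_nonzero; lra).
    assert (E2 : INR (fact (2 * n + 2)) = (2 * INR n + 2) * ((2 * INR n + 1) * INR (fact (2 * n)))).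
    { replace (2 * n + 2)%nat with (S (S (2 * n))) by lia.
      rewrite !fact_simpl, !mult_INR, !S_INR, mult_INR. simpl. ring. }
    assert (E1 : INR (fact (S n)) = (INR n + 1) * INR (fact n)).
    { rewrite fact_simpl, mult_INR, S_INR. ring. }
    rewrite E2, E1. rewrite !plus_INR, !mult_INR in Hr. simpl (INR 2) in Hr. simpl (INR 1) in Hr.
    apply (Rmult_eq_reg_l ((1 + 1) * INR n + (1 + 1))); [| lra].
    rewrite Hr. cbn [pow]. field. repeat split; trivial; lra.
Qed.

(** [(2n) W_(2n)^2 <= (2n) W_(2n-1) W_(2n) = pi / 2], and [W_(2n)] is [pi / 2] times the
    normalised central binomial coefficient. *)
Lemma central_binomial_bound (n : nat) : (1 <= n)%nat ->
  PI * INR n * (INR (fact (2 * n)) / (4 ^ n * INR (fact n) ^ 2)) ^ 2 <= 1.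
Proof.
  intros Hn. pose proof PI_RGT_0 as Hpi.
  pose proof (wallis_mul_succ (2 * n - 1)) as Hm.
  pose proof (wallis_decr (2 * n - 1)) as Hd.
  replace (S (2 * n - 1)) with (2 * n)%nat in Hd by lia.
  replace (2 * n - 1 + 1)%nat with (2 * n)%nat in Hm by lia.
  assert (HN : 1 <= INR n) by (apply (le_INR 1); lia).
  rewrite mult_INR in Hm. simpl (INR 2) in Hm.
  assert (Hsq : 2 * INR n * (wallis (2 * n) * wallis (2 * n)) <= PI / 2).
  { rewrite <- Hm. apply Rmult_le_compat_l; [lra |]. apply Rmult_le_compat_r; lra. }
  rewrite wallis_even in Hsq.
  set (c := INR (fact (2 * n)) / (4 ^ n * INR (fact n) ^ 2)) in *.
  apply (Rmult_le_reg_l (PI / 2)); [lra |].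
  replace (PI / 2 * 1) with (PI / 2) by ring.
  eapply Rle_trans; [| exact Hsq]. right. field.
Qed.

(** * Stirling sequence and its behaviour under doubling *)

Definition log_stirling (n : nat) : R :=
  ln (INR (fact n)) - ((INR n + / 2) * ln (INR n) - INR n).

(** The terms in [n ln n] and [n] cancel in the combination on the right, which
    equals [ln (2 pi) / 2 - ln (pi n c^2) / 2] with [c = binom(2n, n) / 4^n]. *)
Lemma log_stirling_double (n : nat) : (1 <= n)%nat ->
  / 2 * ln (2 * PI) <= 2 * log_stirling n - log_stirling (2 * n).
Proof.
  intros Hn. pose proof PI_RGT_0 as Hpi.
  assert (HN : 1 <= INR n) by (apply (le_INR 1); lia).
  assert (F1 := INR_fact_lt_0 n). assert (F2 := INR_fact_lt_0 (2 * n)).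
  assert (P4 : 0 < 4 ^ n) by (apply pow_lt; lra).
  pose proof (central_binomial_bound n Hn) as Hb.
  assert (Hc : 0 < INR (fact (2 * n)) / (4 ^ n * INR (fact n) ^ 2)).
  { apply Rdiv_lt_0_compat; [lra |]. apply Rmult_lt_0_compat; [lra | apply pow_lt; lra]. }
  apply ln_le in Hb.
  2:{ apply Rmult_lt_0_compat; [nra | apply pow_lt; exact Hc]. }
  assert (Hl : forall k x, 0 < x -> ln (x ^ k) = INR k * ln x) by (intros; apply ln_pow; assumption).
  rewrite ln_1, ln_mult, Hl, ln_div, !ln_mult, !Hl in Hb;
    try (apply pow_lt); try nra; try (apply Rmult_lt_0_compat; [lra | apply pow_lt; lra]).
  replace 4 with (2 * 2) in Hb by lra.
  rewrite (ln_mult 2 2) in Hb by lra. simpl (INR 2) in Hb.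
  unfold log_stirling. rewrite mult_INR. simpl (INR 2).
  replace (1 + 1) with 2 by lra.
  rewrite (ln_mult 2 PI), (ln_mult 2 (INR n)) by lra.
  nra.
Qed.

(** * Bounds for the logarithm *)

Lemma nonneg_of_derive_nonneg (g g' : R -> R) (u : R) :
  0 <= u -> g 0 = 0 ->
  (forall x, 0 <= x <= u -> is_derive g x (g' x)) ->
  (forall x, 0 <= x <= u -> 0 <= g' x) ->
  0 <= g u.
Proof.
  intros Hu H0 Hd Hp.
  destruct (MVT_gen g 0 u g') as [c [Hc Heq]].
  - intros x Hx. rewrite Rmin_left, Rmax_right in Hx by lra. apply Hd. lra.
  - intros x Hx. rewrite Rmin_left, Rmax_right in Hx by lra.
    apply continuity_pt_filterlim, (ex_derive_continuous g).
    exists (g' x). apply Hd. lra.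
  - rewrite Rmin_left, Rmax_right in Hc by lra. specialize (Hp c Hc). nra.
Qed.

(** The difference of the two sides has derivative [2 u^10 / (1 - u^2)], the tail of the
    geometric series for [2 / (1 - u^2)]. *)
Lemma log_ratio_lower (u : R) : 0 <= u < 1 ->
  2 * (u + u ^ 3 / 3 + u ^ 5 / 5 + u ^ 7 / 7 + u ^ 9 / 9) <= ln ((1 + u) / (1 - u)).
Proof.
  intros Hu.
  cut (0 <= ln ((1 + u) / (1 - u)) - 2 * (u + u ^ 3 / 3 + u ^ 5 / 5 + u ^ 7 / 7 + u ^ 9 / 9));
    [lra |].
  apply (nonneg_of_derive_nonneg
    (fun x => ln ((1 + x) / (1 - x)) - 2 * (x + x ^ 3 / 3 + x ^ 5 / 5 + x ^ 7 / 7 + x ^ 9 / 9))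
    (fun x => 2 * x ^ 10 / (1 - x ^ 2))); [lra | | |].
  - replace ((1 + 0) / (1 - 0)) with 1 by field. rewrite ln_1. field.
  - intros x Hx. auto_derive.
    + repeat split; try lra. apply Rdiv_lt_0_compat; lra.
    + field. repeat split; nra.
  - intros x Hx. apply Rdiv_le_0_compat; [| nra].
    pose proof (pow_le x 10 ltac:(lra)). lra.
Qed.

(** A crude companion bound: at [u = 1 / (2 n + 1)] its right-hand side is
    [(1/n + 1/(n+1)) / 2], the trapezoidal estimate of the integral of [1/x] over
    [[n, n+1]]. *)
Lemma log_ratio_upper (u : R) : 0 <= u < 1 -> ln ((1 + u) / (1 - u)) <= 2 * u / (1 - u ^ 2).
Proof.
  intros Hu.
  cut (0 <= 2 * u / (1 - u ^ 2) - ln ((1 + u) / (1 - u))); [lra |].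
  apply (nonneg_of_derive_nonneg
    (fun x => 2 * x / (1 - x ^ 2) - ln ((1 + x) / (1 - x)))
    (fun x => 4 * x ^ 2 / (1 - x ^ 2) ^ 2)); [lra | | |].
  - replace ((1 + 0) / (1 - 0)) with 1 by field. rewrite ln_1. field.
  - intros x Hx. auto_derive.
    + repeat split; try nra. apply Rdiv_lt_0_compat; lra.
    + field. repeat split; nra.
  - intros x Hx. apply Rdiv_le_0_compat; [nra | apply pow_lt; nra].
Qed.

(** * The rational correction term *)

Definition correction (x : R) : R :=
  1 / (12 * x) - 1 / (360 * x ^ 3) + 1 / (1260 * x ^ 5 + 945 * x ^ 3).

Lemma correction_eq (x : R) : 0 < x ->
  correction x = (840 * x ^ 4 + 602 * x ^ 2 - 13) / (2520 * x ^ 3 * (4 * x ^ 2 + 3)).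
Proof.
  intros Hx. unfold correction.
  replace (1260 * x ^ 5 + 945 * x ^ 3) with (315 * x ^ 3 * (4 * x ^ 2 + 3)) by ring.
  field. split; [nra | lra].
Qed.

(** In the variable [s = (2 x + 1)^2] the difference of the two sides is an explicit
    rational function: the map [x -> - 1 - x] exchanges [x] and [x + 1] up to sign and
    [correction] is odd, so only even powers of [2 x + 1] occur. All terms of the
    numerator of degree above 4 in [s] cancel, and the rest is positive for [s >= 9]. *)
Lemma correction_diff (x : R) : 1 <= x ->
  let u := / (2 * x + 1) in
  correction x - correction (x + 1) <= u ^ 2 / 3 + u ^ 4 / 5 + u ^ 6 / 7 + u ^ 8 / 9.
Proof.
  intros Hx u. set (s := (2 * x + 1) ^ 2).
  assert (Hs : 9 <= s) by (unfold s; nra).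
  assert (E : u ^ 2 / 3 + u ^ 4 / 5 + u ^ 6 / 7 + u ^ 8 / 9 - (correction x - correction (x + 1))
     = (1119 * s ^ 4 - 328 * s ^ 3 - 323 * s ^ 2 + 820 * s - 560)
       / (315 * s ^ 4 * (s - 1) ^ 3 * (s ^ 2 + 4 * s + 16))).
  { rewrite !correction_eq by lra. unfold u, s. field. repeat split; nra. }
  cut (0 <= (1119 * s ^ 4 - 328 * s ^ 3 - 323 * s ^ 2 + 820 * s - 560)
       / (315 * s ^ 4 * (s - 1) ^ 3 * (s ^ 2 + 4 * s + 16))); [lra |].
  apply Rdiv_le_0_compat.
  - nra.
  - repeat apply Rmult_lt_0_compat; try apply pow_lt; nra.
Qed.

(** * Monotonicity and limit *)

Lemma inv_odd_bounds (x : R) : 0 < x -> 0 < / (2 * x + 1) < 1.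
Proof.
  intros Hx. split; [apply Rinv_0_lt_compat; lra |].
  rewrite <- Rinv_1. apply Rinv_lt_contravar; lra.
Qed.

(** The choice of [u] makes [(1 + u) / (1 - u) = (n + 1) / n] and [1 / (2 u) = n + 1 / 2]. *)
Lemma log_stirling_step (n : nat) : (1 <= n)%nat ->
  let u := / (2 * INR n + 1) in
  log_stirling n - log_stirling (S n) = / (2 * u) * ln ((1 + u) / (1 - u)) - 1.
Proof.
  intros Hn u.
  assert (HN : 1 <= INR n) by (apply (le_INR 1); lia).
  assert (Hr : (1 + u) / (1 - u) = (INR n + 1) / INR n) by (unfold u; field; lra).
  rewrite Hr, ln_div by lra.
  unfold log_stirling. rewrite fact_simpl, mult_INR, S_INR.
  rewrite ln_mult by (try apply INR_fact_lt_0; lra).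
  unfold u. field. lra.
Qed.

Lemma log_stirling_step_lower (n : nat) : (1 <= n)%nat ->
  correction (INR n) - correction (INR (S n)) <= log_stirling n - log_stirling (S n).
Proof.
  intros Hn.
  assert (HN : 1 <= INR n) by (apply (le_INR 1); lia).
  rewrite log_stirling_step by assumption. rewrite S_INR.
  eapply Rle_trans; [apply correction_diff; exact HN |].
  set (u := / (2 * INR n + 1)).
  assert (Hu : 0 < u < 1) by (apply inv_odd_bounds; lra).
  pose proof (log_ratio_lower u ltac:(lra)) as Hl.
  apply (Rmult_le_compat_l (/ (2 * u))) in Hl; [| left; apply Rinv_0_lt_compat; lra].
  replace (/ (2 * u) * (2 * (u + u ^ 3 / 3 + u ^ 5 / 5 + u ^ 7 / 7 + u ^ 9 / 9)))
    with (1 + (u ^ 2 / 3 + u ^ 4 / 5 + u ^ 6 / 7 + u ^ 8 / 9)) in Hl by (field; lra).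
  lra.
Qed.

Lemma log_stirling_step_upper (n : nat) : (1 <= n)%nat ->
  log_stirling n - log_stirling (S n) <= / (4 * INR n) - / (4 * INR (S n)).
Proof.
  intros Hn.
  assert (HN : 1 <= INR n) by (apply (le_INR 1); lia).
  rewrite log_stirling_step by assumption. rewrite S_INR.
  set (u := / (2 * INR n + 1)).
  assert (Hu : 0 < u < 1) by (apply inv_odd_bounds; lra).
  pose proof (log_ratio_upper u ltac:(lra)) as Hl.
  apply (Rmult_le_compat_l (/ (2 * u))) in Hl; [| left; apply Rinv_0_lt_compat; lra].
  replace (/ (2 * u) * (2 * u / (1 - u ^ 2)))
    with (1 + (/ (4 * INR n) - / (4 * (INR n + 1)))) in Hl.
  - lra.
  - unfold u. field. repeat split; nra.
Qed.

(** The lower bound is used when comparing with [log_stirling (2 n)]; the upper bound both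
    bounds [log_stirling - correction] from below and sends the correction to [0]. *)
Lemma correction_bounds (x : R) : 1 <= x -> 0 <= correction x <= / (4 * x).
Proof.
  intros Hx. rewrite correction_eq by lra.
  assert (Hden : 0 < 2520 * x ^ 3 * (4 * x ^ 2 + 3)).
  { repeat apply Rmult_lt_0_compat; try apply pow_lt; nra. }
  split; [apply Rdiv_le_0_compat; nra |].
  cut (0 <= (1680 * x ^ 4 + 1288 * x ^ 2 + 13) / (2520 * x ^ 3 * (4 * x ^ 2 + 3))).
  - intros H. apply Rminus_le_0. eapply Rle_trans; [exact H |].
    right. field. split; nra.
  - apply Rdiv_le_0_compat; nra.
Qed.

(** The right-hand side increases by [log_stirling_step_upper] and starts at [3 / 4]. *)
Lemma log_stirling_ge (n : nat) : (1 <= n)%nat -> 3 / 4 <= log_stirling n - / (4 * INR n).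
Proof.
  intros Hn. induction Hn as [|n Hn IH].
  - unfold log_stirling. simpl. rewrite ln_1. lra.
  - pose proof (log_stirling_step_upper n Hn). lra.
Qed.

(** If [r] is the decreasing sequence with limit [l], then
    [2 r n >= ln (2 pi) / 2 + r (2 n) - 2 correction n] and [r (2 n) >= l]; letting [n]
    tend to infinity leaves [2 l >= ln (2 pi) / 2 + l]. *)
Lemma log_stirling_sub_correction_ge (n : nat) : (1 <= n)%nat ->
  / 2 * ln (2 * PI) <= log_stirling n - correction (INR n).
Proof.
  (* The index is shifted by one, since [ln 0] and [/ 0] carry no information. *)
  set (r := fun k => log_stirling (S k) - correction (INR (S k))).
  assert (Hpos : forall k, 1 <= INR (S k)) by (intros k; apply (le_INR 1); lia).
  assert (Hdecr : Un_decreasing r).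
  { intros k. unfold r. pose proof (log_stirling_step_lower (S k) ltac:(lia)). lra. }
  assert (Hlb : has_lb r).
  { exists (- (3 / 4)). intros y [k ->]. unfold opp_seq, r.
    pose proof (log_stirling_ge (S k) ltac:(lia)).
    pose proof (correction_bounds (INR (S k)) (Hpos k)). lra. }
  destruct (decreasing_cv r Hdecr Hlb) as [l Hl].
  pose proof (decreasing_ineq r l Hdecr Hl) as Hge.
  cut (/ 2 * ln (2 * PI) <= l).
  { intros H Hn. specialize (Hge (n - 1)%nat). unfold r in Hge.
    replace (S (n - 1)) with n in Hge by lia. lra. }
  assert (Hinv : is_lim_seq (fun k => / 2 * / INR (S k)) (/ 2 * 0)).
  { apply (is_lim_seq_scal_l _ (/ 2) 0).
    apply (is_lim_seq_inv _ p_infty); [| discriminate].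
    apply -> (is_lim_seq_incr_1 INR). exact is_lim_seq_INR. }
  apply is_lim_seq_Reals in Hl.
  assert (Hlim : is_lim_seq (fun k => 2 * r k + / 2 * / INR (S k)) (2 * l + / 2 * 0)).
  { apply (is_lim_seq_plus' _ _ _ _); [| exact Hinv].
    apply (is_lim_seq_scal_l r 2 l Hl). }
  cut (/ 2 * ln (2 * PI) + l <= 2 * l + / 2 * 0); [lra |].
  refine (is_lim_seq_le _ _ (Finite _) (Finite _) _ (is_lim_seq_const _) Hlim).
  intros k.
  pose proof (log_stirling_double (S k) ltac:(lia)) as Hd.
  pose proof (correction_bounds (INR (S k)) (Hpos k)) as Hc.
  pose proof (Hge (2 * k + 1)%nat) as H2.
  unfold r in *. replace (S (2 * k + 1)) with (2 * S k)%nat in H2 by lia.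
  assert (1 <= INR (2 * S k)) by (apply (le_INR 1); lia).
  pose proof (correction_bounds (INR (2 * S k)) ltac:(assumption)) as Hc2.
  replace (/ 2 * / INR (S k)) with (2 * / (4 * INR (S k))) by (field; specialize (Hpos k); lra).
  lra.
Qed.

Theorem mainTheorem4 (n : nat) (hn : (1 <= n)%nat) :
  INR (fact n) >=
    sqrt (2 * PI * INR n) * (INR n / exp 1) ^ n *
    exp (1 / (12 * INR n) - 1 / (360 * INR n ^ 3)
         + 1 / (1260 * INR n ^ 5 + 945 * INR n ^ 3)).
Proof.
  pose proof PI_RGT_0 as Hpi.
  assert (HN : 1 <= INR n) by (apply (le_INR 1); lia).
  pose proof (exp_pos 1) as He.
  pose proof (log_stirling_sub_correction_ge n hn) as H.
  fold (correction (INR n)). set (c := correction (INR n)) in *.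
  assert (Hs : 0 < sqrt (2 * PI * INR n)) by (apply sqrt_lt_R0; nra).
  assert (Hq : 0 < INR n / exp 1) by (apply Rdiv_lt_0_compat; lra).
  assert (Hqn : 0 < (INR n / exp 1) ^ n) by (apply pow_lt; exact Hq).
  assert (Hln_sqrt : ln (sqrt (2 * PI * INR n)) = / 2 * (ln (2 * PI) + ln (INR n))).
  { rewrite <- Rpower_sqrt by nra. unfold Rpower. rewrite ln_exp, ln_mult by lra. reflexivity. }
  apply Rle_ge, Rnot_lt_le. intros Hlt.
  apply ln_increasing in Hlt; [| apply INR_fact_lt_0].
  rewrite !ln_mult in Hlt by (try apply Rmult_lt_0_compat; try assumption; apply exp_pos).
  rewrite ln_exp, ln_pow, ln_div, ln_exp, Hln_sqrt in Hlt by (assumption || lra).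
  unfold log_stirling in H. lra.
Qed.
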